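(* Let $N\ge 3$ and let $I$ be an isocone of $M_N(\mathbb{C})$. Then $I=\mathrm{Herm}(N)$.
   Context: $\mathrm{Herm}(N)$ is the set of hermitian $N\times N$ complex matrices, $1_N$ is the unit matrix, and $I(\mathbb{R})$ is the set of continuous non-decreasing functions $\mathbb{R}\to\mathbb{R}$. An isocone of $M_N(\mathbb{C})$ is a subset $I\subset\mathrm{Herm}(N)$ such that: (1) $x 1_N\in I$ for all $x\in\mathbb{R}$; (2) $b+b'\in I$ for all $b,b'\in I$; (3) $\phi(b)\in I$ for all $b\in I$ and $\phi\in I(\mathbb{R})$ (functional calculus); (4) $I$ is norm-closed; (5) $\overline{I-I}=\mathrm{Herm}(N)$, where $I-I=\{b-b':b,b'\in I\}$ and the bar denotes norm closure. *)

(* Defs.v *)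
From HB Require Import structures.
From mathcomp Require Import all_boot all_order all_algebra.
From mathcomp Require Import complex.
From mathcomp Require Import all_classical all_reals all_analysis.

Set Implicit Arguments.
Unset Strict Implicit.
Unset Printing Implicit Defensive.

Import Order.TTheory GRing.Theory Num.Theory.
Import numFieldNormedType.Exports.

Local Open Scope classical_set_scope.
Local Open Scope ring_scope.
Local Open Scope complex_scope.
Local Open Scope sesquilinear_scope.

(* For R : realType, the complex field is R[i]. The norm topology on matrices
   is that of the normed module 'M[R[i]^o]_N (sup of the moduli of the entries);
   all norms are equivalent in finite dimension, so it is also the topology of
   the C*-norm. The regular module R[i]^o is convertible to R[i], but only the
   former carries the topology, whence the casts below. *)

Definition Herm (R : realType) (N : nat) : set 'M[R[i]]_N :=
  [set b | b \is hermsymmx].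

Definition Iso (R : realType) : set (R -> R) :=
  [set phi : R -> R | continuous phi /\ {homo phi : x y / x <= y}].

Arguments Herm : clear implicits.
Arguments Iso : clear implicits.

(* Functional calculus. The library's spectral theorem reads
   b = invmx P *m diag_mx d *m P with P := spectralmx b unitary and
   d := spectral_diag b; the entries of d are real when b is hermitian, so Re
   only changes their type. By funcalcE below the result does not depend on the
   diagonalization. *)
Definition funcalc (R : realType) (N : nat) (phi : R -> R) (b : 'M[R[i]]_N) :
    'M[R[i]]_N :=
  invmx (spectralmx b)
    *m diag_mx (\row_j (phi (complex.Re (spectral_diag b 0 j)))%:C)
    *m spectralmx b.

Lemma funcalcE (R : realType) (N : nat) (phi : R -> R) (P : 'M[R[i]]_N)
    (d : 'rV[R]_N) : P \is unitarymx ->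
  funcalc phi (P ^t* *m diag_mx (\row_j (d 0 j)%:C) *m P) =
  P ^t* *m diag_mx (\row_j (phi (d 0 j))%:C) *m P.
Proof.
move=> Pu; set A := _ *m P; set D := diag_mx _ in A *.
have Ah : A \is hermsymmx.
  rewrite qualifE /= expr0 scale1r /A !trmx_mul !map_mxM /= mulmxA trmxCK.
  suff -> : D ^t* = D by [].
  rewrite /D tr_diag_mx map_diag_mx; apply: congr1.
  apply/rowP=> j; rewrite !mxE.
  by apply/CrealP; rewrite complex_real.
have /orthomx_spectralP As := hermitian_normalmx Ah.
have /mxOverP Ar := hermitian_spectral_diag_real Ah.
rewrite /funcalc; set Q := spectralmx A in As *.
have Qu : Q \is unitarymx by exact: spectral_unitarymx.
set e := spectral_diag A in As Ar *.
have PV : invmx P = P ^t* by rewrite (invmx_unitary Pu).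
have Pi := unitarymx_unit Pu; have Qi := unitarymx_unit Qu.
pose U := P *m invmx Q.
have UE : U *m diag_mx e = D *m U.
  have : P *m A *m invmx Q = P *m (invmx Q *m diag_mx e *m Q) *m invmx Q.
    by rewrite {1}As.
  rewrite /A -PV !mulmxA mulmxV // mul1mx -/D /U => /esym.
  by rewrite -!mulmxA mulmxV // mulmx1 !mulmxA.
have UF : U *m diag_mx (\row_j (phi (complex.Re (e 0 j)))%:C) =
          diag_mx (\row_j (phi (d 0 j))%:C) *m U.
  move: (U) UE => V VE.
  apply/matrixP=> i j; have /matrixP/(_ i j) := VE.
  rewrite !mul_mx_diag !mul_diag_mx !mxE => H.
  have [->|V0] := eqVneq (V i j) 0; first by rewrite mulr0 mul0r.
  rewrite mulrC; congr (_ * _).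
  have -> : e 0 j = (d 0 i)%:C by apply: (mulfI V0); rewrite H mulrC.
  by [].
have KQ (X : 'M[R[i]]_N) : invmx P *m (U *m X) *m Q = invmx Q *m X *m Q.
  by rewrite /U -(mulmxA P) (mulKmx Pi).
have KP (X : 'M[R[i]]_N) : invmx P *m (X *m U) *m Q = P ^t* *m X *m P.
  by rewrite -PV /U !mulmxA (mulmxKV Qi).
rewrite -[LHS]KQ -[RHS]KP; exact: (congr1 (fun X => invmx P *m X *m Q) UF).
Qed.

Record isocone (R : realType) (N : nat) (I : set 'M[R[i]]_N) : Prop := {
  isocone_herm : I `<=` Herm R N ;
  isocone_scalar : forall x : R, I (x%:C)%:M ;
  isoconeD : forall b b', I b -> I b' -> I (b + b') ;
  isocone_funcalc : forall b phi, I b -> Iso R phi -> I (funcalc phi b) ;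
  isocone_closed : closed (I : set 'M[R[i]^o]_N) ;
  isocone_dense :
    closure ([set b - b' | b in I & b' in I] : set 'M[R[i]^o]_N) = Herm R N }.

(* Main.v *)
(* A closed convex cone stable under monotone functional calculus is governed by
   the lines [C v] whose rank one projection it contains. If [I] contains the
   lines of [x], [y] and [v + n], with [v] in the plane of [x] and [y] and [n]
   orthogonal to it, then it contains the line of [v]: perturb the projection on
   the plane by a small multiple of that on [v + n] and take the top eigenspace.
   Since [I] spans Herm(N), it has an interior point, and perturbing the top
   eigenvector [u] of that point gives a cap of lines around [u]. On a sphere the
   vertices of the right angles over a diameter of a cap lie outside the cap, so
   projecting on planes enlarges it; this needs a third dimension. The squared
   tangent [s] of the radius becomes [s / (1 - s)], that is, [1 / s] drops by [1],
   so after finitely many steps the cap contains all lines not orthogonal to [u],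
   hence by closedness all lines, and these generate Herm(N). *)

Require Import Defs.
From HB Require Import structures.
From mathcomp Require Import all_boot all_order all_algebra.
From mathcomp Require Import complex.
From mathcomp Require Import all_classical all_reals all_analysis.
From mathcomp Require Import ring lra.

Local Open Scope classical_set_scope.
Local Open Scope ring_scope.
Local Open Scope complex_scope.

Import Order.TTheory GRing.Theory Num.Theory.
Import numFieldNormedType.Exports.
Local Open Scope sesquilinear_scope.

Local Notation "''[' u , v ]" := (dotmx u v) : ring_scope.
Local Notation "''[' u ]" := (dotmx u u) : ring_scope.

(** * Hermitian matrices acting on row vectors, and their functional calculus *)

Section FunctionalCalculus.
Set Implicit Arguments.
Unset Strict Implicit.
Variables (R : realType) (N : nat).
Local Notation C := R[i].
Implicit Types (b p : 'M[C]_N) (u v w y : 'rV[C]_N).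

Lemma trmxC_mul m n k (A : 'M[C]_(m, n)) (B : 'M[C]_(n, k)) :
  (A *m B)^t* = B^t* *m A^t*.
Proof. by rewrite trmx_mul map_mxM. Qed.

Lemma trmxCD m n (A B : 'M[C]_(m, n)) : (A + B)^t* = A^t* + B^t*.
Proof. by rewrite linearD map_mxD. Qed.

Lemma trmxCZ m n (a : C) (A : 'M[C]_(m, n)) : (a *: A)^t* = Num.conj a *: A^t*.
Proof. by rewrite linearZ map_mxZ. Qed.

Lemma trmxCN m n (A : 'M[C]_(m, n)) : (- A)^t* = - A^t*.
Proof. by rewrite linearN map_mxN. Qed.

Lemma trmxC_sum (T : Type) (s : seq T) m n (F : T -> 'M[C]_(m, n)) :
  (\sum_(i <- s) F i)^t* = \sum_(i <- s) (F i)^t*.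
Proof.
elim/big_ind2: _ => //; first by rewrite trmx0 map_mx0.
by move=> A A' B B' <- <-; exact: trmxCD.
Qed.

Lemma hermP b : b \is hermsymmx <-> b^t* = b.
Proof.
rewrite qualifE /= expr0 scale1r; split=> [/eqP <-//|h]; exact/eqP/esym.
Qed.

Lemma herm_trmxC b : b \is hermsymmx -> b^t* = b.
Proof. by move/hermP. Qed.

Lemma conj_real (x : R) : Num.conj (x%:C : C) = x%:C.
Proof. by apply/CrealP; rewrite complex_real. Qed.

Lemma hermD b b' : b \is hermsymmx -> b' \is hermsymmx -> b + b' \is hermsymmx.
Proof. by move=> /hermP h /hermP h'; apply/hermP; rewrite trmxCD h h'. Qed.

Lemma hermB b b' : b \is hermsymmx -> b' \is hermsymmx -> b - b' \is hermsymmx.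
Proof. by move=> /hermP h /hermP h'; apply/hermP; rewrite trmxCD trmxCN h h'. Qed.

Lemma hermZ (x : R) b : b \is hermsymmx -> x%:C *: b \is hermsymmx.
Proof. by move=> /hermP h; apply/hermP; rewrite trmxCZ h conj_real. Qed.

Lemma herm_scalar (x : R) : ((x%:C)%:M : 'M[C]_N) \is hermsymmx.
Proof. by apply/hermP; rewrite tr_scalar_mx map_scalar_mx/= conj_real. Qed.

Lemma herm_rank1 u : u^t* *m u \is hermsymmx.
Proof. by apply/hermP; rewrite trmxC_mul trmxCK. Qed.

Lemma mul_rank1 u v w : u *m (v^t* *m w) = '[u, v] *: w.
Proof. by rewrite mulmxA [u *m _]mx11_scalar -dotmxE mul_scalar_mx. Qed.

Lemma dotDl u v w : '[u + v, w] = '[u, w] + '[v, w].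
Proof. exact: linearDl. Qed.

Lemma dotDr u v w : '[u, v + w] = '[u, v] + '[u, w].
Proof. exact: linearDr. Qed.

Lemma dotBl u v w : '[u - v, w] = '[u, w] - '[v, w].
Proof. exact: linearBl. Qed.

Lemma dotBr u v w : '[u, v - w] = '[u, v] - '[u, w].
Proof. exact: linearBr. Qed.

Lemma dotZl (a : C) u v : '[a *: u, v] = a * '[u, v].
Proof. exact: linearZl_LR. Qed.

Lemma dotZr (x : R) u v : '[u, x%:C *: v] = x%:C * '[u, v].
Proof. by rewrite linearZr_LR; congr (_ * _); exact: conj_real. Qed.

Lemma dot0l u : '[0, u] = 0.
Proof. exact: linear0l. Qed.

Lemma dot0r u : '[u, 0] = 0.
Proof. exact: linear0r. Qed.

Lemma dotC u v : '[u, v] = Num.conj '[v, u].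
Proof. by rewrite hermC expr0 mul1r. Qed.

Lemma dot_mulC u v : '[u, v] * '[v, u] = `|'[u, v]| ^+ 2.
Proof. by rewrite normCK -dotC. Qed.

Lemma dot_eq0C u v : '[u, v] = 0 -> '[v, u] = 0.
Proof. by move=> h; rewrite dotC h rmorph0. Qed.

Lemma dot_herm b u v : b \is hermsymmx -> '[u *m b, v] = '[u, v *m b].
Proof. by move=> /hermP bh; rewrite !dotmxE trmxC_mul bh mulmxA. Qed.

Definition conj_diag (P : 'M[C]_N) (d : 'rV[R]_N) : 'M[C]_N :=
  P^t* *m diag_mx (\row_j (d 0 j)%:C) *m P.

Lemma spectralP b : b \is hermsymmx ->
  exists P d, P \is unitarymx /\ b = conj_diag P d.
Proof.
move=> bh; have /orthomx_spectralP bs := hermitian_normalmx bh.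
have /mxOverP br := hermitian_spectral_diag_real bh.
exists (spectralmx b), (\row_j complex.Re (spectral_diag b 0 j)).
have Pu := spectral_unitarymx b; split => //.
rewrite /conj_diag -(invmx_unitary Pu).
move: bs br; move: (spectralmx b) (spectral_diag b) => P e -> er.
suff {1}-> : e = \row_j ((\row_j complex.Re (e 0 j)) 0 j)%:C by [].
by apply/rowP=> j; rewrite !mxE RRe_real.
Qed.

Lemma funcalc_conj_diag phi P d : P \is unitarymx ->
  funcalc phi (conj_diag P d) = conj_diag P (map_mx phi d).
Proof.
move=> Pu; rewrite /conj_diag (funcalcE phi d Pu).
suff -> : \row_j (map_mx phi d 0 j)%:C = \row_j (phi (d 0 j))%:C :> 'rV[C]_N by [].
by apply/rowP=> j; rewrite !mxE.
Qed.

Lemma herm_conj_diag P d : conj_diag P d \is hermsymmx.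
Proof.
apply/hermP; rewrite /conj_diag !trmxC_mul trmxCK mulmxA.
suff -> : (diag_mx (\row_j (d 0 j)%:C))^t* =
  diag_mx (\row_j (d 0 j)%:C) :> 'M[C]_N by [].
rewrite tr_diag_mx map_diag_mx; apply: congr1.
by apply/rowP=> j; rewrite !mxE; exact: conj_real.
Qed.

Lemma row_conj_diag P d j : P \is unitarymx ->
  row j P *m conj_diag P d = (d 0 j)%:C *: row j P.
Proof.
move=> /unitarymxP Pu; rewrite -row_mul /conj_diag !mulmxA Pu mul1mx.
by apply/rowP=> k; rewrite mul_diag_mx !mxE.
Qed.

Lemma conj_diagE P d : conj_diag P d = \sum_j (d 0 j)%:C *: ((row j P)^t* *m row j P).
Proof.
apply/matrixP=> k l; rewrite /conj_diag -mulmxA mul_diag_mx summxE !mxE.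
by apply: eq_bigr => j _; rewrite !mxE big_ord1 !mxE mulrCA.
Qed.

Lemma conj_diag_const P (x : R) : P \is unitarymx ->
  conj_diag P (const_mx x) = (x%:C)%:M.
Proof.
rewrite -trmxC_unitary => /unitarymxP; rewrite trmxCK => PP.
rewrite /conj_diag (_ : \row_j _ = const_mx x%:C); last first.
  by apply/rowP => j; rewrite !mxE.
by rewrite diag_const_mx mul_mx_scalar -scalemxAl PP scalemx1.
Qed.

Lemma conj_diagB P (d e : 'rV[R]_N) :
  conj_diag P d - conj_diag P e = conj_diag P (d - e).
Proof.
rewrite !conj_diagE -sumrB; apply: eq_bigr => j _.
by rewrite -scalerBl -rmorphB !mxE.
Qed.

Lemma conj_diag_ge0 P (d : 'rV[R]_N) y : (forall j, 0 <= d 0 j) ->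
  0 <= '[y *m conj_diag P d, y].
Proof.
move=> d0; rewrite conj_diagE mulmx_sumr.
rewrite (_ : '[_, _] = \sum_j (d 0 j)%:C * ('[y, row j P] * '[row j P, y])).
  by apply: sumr_ge0 => j _; rewrite dot_mulC mulr_ge0 ?ler0c// exprn_ge0.
rewrite linear_sumlz; apply: eq_bigr => j _.
by rewrite /= -scalemxAr mul_rank1 2!dotZl.
Qed.

Lemma conj_diag_mulr_eq0 P (d : 'rV[R]_N) m (X : 'M[C]_(N, m)) :
  (forall j, (d 0 j)%:C *: (row j P *m X) = 0) -> conj_diag P d *m X = 0.
Proof.
move=> h; rewrite conj_diagE mulmx_suml big1 // => j _.
by rewrite -scalemxAl -mulmxA scalemxAr h mulmx0.
Qed.

Lemma funcalc_herm phi b : b \is hermsymmx -> funcalc phi b \is hermsymmx.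
Proof.
by move=> /spectralP[P [d [Pu ->]]]; rewrite funcalc_conj_diag// herm_conj_diag.
Qed.

(** In the eigenbasis the equation kills every column of [X] whose eigenvalue differs from [l].
    Several rows are allowed so that [X] can be an eigenvector or a whole spectral projection. *)
Lemma funcalc_eigen phi b m (X : 'M[C]_(m, N)) (l : R) : b \is hermsymmx ->
  X *m b = l%:C *: X -> X *m funcalc phi b = (phi l)%:C *: X.
Proof.
move=> /spectralP[P [d [Pu ->]]]; rewrite funcalc_conj_diag// => Xb.
have Pi := unitarymx_unit Pu; have PV := invmx_unitary Pu.
move: Xb; rewrite /conj_diag -PV !mulmxA => Xb.
have {}Xb : X *m invmx P *m diag_mx (\row_j (d 0 j)%:C) = l%:C *: (X *m invmx P).
  by rewrite scalemxAl -Xb mulmxK.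
suff -> : X *m invmx P *m diag_mx (\row_j (map_mx phi d 0 j)%:C) =
  (phi l)%:C *: (X *m invmx P) by rewrite -scalemxAl mulmxKV.
move: (X *m invmx P) Xb => Y /matrixP Yd; apply/matrixP => i j.
have := Yd i j; rewrite !mul_mx_diag !mxE => h.
have [->|Y0] := eqVneq (Y i j) 0; first by rewrite mul0r mulr0.
rewrite mulrC; have -> : d 0 j = l; last by [].
apply: (@complexI R).
by apply: (mulIf Y0); rewrite mulrC h.
Qed.

Lemma funcalcZ (c : R) b : b \is hermsymmx -> funcalc ( *%R c) b = c%:C *: b.
Proof.
move=> /spectralP[P [d [Pu ->]]]; rewrite funcalc_conj_diag// !conj_diagE.
rewrite scaler_sumr; apply: eq_bigr => j _.
by rewrite !mxE scalerA rmorphM.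
Qed.

(* [p] is the spectral projection of [c] for its isolated top eigenvalue [l]. *)
Lemma funcalc_top c p (l g : R) : c \is hermsymmx -> p \is hermsymmx ->
  p *m p = p -> p *m c = l%:C *: p -> g < l ->
  (forall y, y *m p = 0 -> '[y *m c, y] <= g%:C * '[y]) ->
  funcalc (fun x => Num.max (x - g) 0) c = (l - g)%:C *: p.
Proof.
move=> ch ph pp pc gl yc; set phi := fun x => _.
have fh : funcalc phi c \is hermsymmx by exact: (funcalc_herm phi ch).
have pf : p *m funcalc phi c = (l - g)%:C *: p.
  by rewrite (funcalc_eigen phi ch pc) /phi max_l ?subr_ge0 ?ltW.
(* Taking adjoints, the left factor [1 - p] is killed as well, so [funcalc phi c] equals
   [p *m funcalc phi c]. *)
suff f1 : funcalc phi c *m (1%:M - p) = 0.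
  have := f1; move/(congr1 (fun X => X^t*)).
  rewrite trmxC_mul (herm_trmxC fh) trmx0 map_mx0.
  rewrite linearB map_mxB /= tr_scalar_mx map_scalar_mx rmorph1 (herm_trmxC ph).
  by rewrite mulmxBl mul1mx pf => /eqP; rewrite subr_eq0 => /eqP.
have [P [d [Pu cE]]] := spectralP ch.
rewrite cE funcalc_conj_diag//; apply: conj_diag_mulr_eq0 => j; rewrite mxE /phi.
have [dg|dg] := leP (d 0 j) g; first by rewrite max_r ?subr_le0// scale0r.
(* An eigenvalue above [g]: since [c] commutes with [p], the part [y] of the eigenvector off [p]
   satisfies the same eigenvalue equation, and the bound off [p] forces [y = 0]. *)
suff -> : row j P *m (1%:M - p) = 0 by rewrite scaler0.
set y := _ *m _.
have yp : y *m p = 0 by rewrite /y -mulmxA mulmxBl mul1mx pp subrr mulmx0.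
have cp : c *m p = p *m c.
  have /(congr1 (fun X => X^t*)) := pc.
  by rewrite trmxC_mul trmxCZ conj_real (herm_trmxC ch) (herm_trmxC ph) -pc.
have yd : y *m c = (d 0 j)%:C *: y.
  rewrite /y -mulmxA mulmxBl mul1mx -cp -{1}(mulmx1 c) -mulmxBr mulmxA.
  by rewrite {1}cE row_conj_diag// -scalemxAl.
have := yc y yp; rewrite yd dotZl -subr_le0 -mulrBl.
have d0 : 0 < (d 0 j)%:C - g%:C :> C by rewrite -rmorphB ltcR subr_gt0.
rewrite pmulr_rle0// => y0.
by apply/eqP; rewrite -(dnorm_eq0 (@dotmx C N)) eq_le y0 dnorm_ge0.
Qed.

End FunctionalCalculus.

(** * Entrywise estimates, and the lines contained in an isocone *)

Section Cone.
Set Implicit Arguments.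
Unset Strict Implicit.
Variables (R : realType) (N : nat).
Local Notation C := R[i].
Implicit Types (b p q : 'M[C]_N) (u v w y n : 'rV[C]_N).

(** The square of the hermitian norm, taken in [R] so that estimates are real. *)
Definition nrm u : R := complex.Re '[u].

Lemma nrmE u : '[u] = (nrm u)%:C.
Proof. by rewrite /nrm RRe_real// ger0_real// dnorm_ge0. Qed.

Lemma nrm_ge0 u : 0 <= nrm u.
Proof. by rewrite -lecR -nrmE dnorm_ge0. Qed.

Lemma nrm_gt0 u : (0 < nrm u) = (u != 0).
Proof. by rewrite -ltcR -nrmE dnorm_gt0. Qed.

Lemma nrmD u v : '[u, v] = 0 -> nrm (u + v) = nrm u + nrm v.
Proof.
move=> h; have := hnormDd h; rewrite /= !nrmE -rmorphD.
exact: complexI.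
Qed.

Lemma normc_ge0 (a : C) : 0 <= ComplexField.Normc.normc a.
Proof. by case: a => ? ?; exact: sqrtr_ge0. Qed.

Definition bounded_entries m k (K : R) (A : 'M[C]_(m, k)) :=
  forall i j, `|A i j| <= K%:C.

Lemma bounded_entries_ex m k (A : 'M[C]_(m, k)) :
  exists2 K : R, 0 < K & bounded_entries K A.
Proof.
exists (1 + \sum_i \sum_j ComplexField.Normc.normc (A i j)) => [|i j].
  rewrite ltr_pwDl// sumr_ge0// => i _.
  by rewrite sumr_ge0// => j _; exact: normc_ge0.
have h := normc_ge0.
rewrite (_ : `|A i j| = (ComplexField.Normc.normc (A i j))%:C)//.
rewrite lecR (bigD1 i)//= (bigD1 j)//= addrA addrCA -!addrA lerDl !addr_ge0//.
  by rewrite sumr_ge0.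
by rewrite sumr_ge0// => ? _; rewrite sumr_ge0.
Qed.

Lemma bounded_entriesW m k (K L : R) (A : 'M[C]_(m, k)) :
  K <= L -> bounded_entries K A -> bounded_entries L A.
Proof. by move=> KL h i j; apply: (le_trans (h i j)); rewrite lecR. Qed.

Lemma bounded_entriesD m k (K L : R) (A B : 'M[C]_(m, k)) :
  bounded_entries K A -> bounded_entries L B -> bounded_entries (K + L) (A + B).
Proof.
move=> hA hB i j; rewrite mxE rmorphD /=.
by apply: (le_trans (ler_normD _ _)); exact: lerD.
Qed.

Lemma bounded_entriesN m k (K : R) (A : 'M[C]_(m, k)) :
  bounded_entries K A -> bounded_entries K (- A).
Proof. by move=> hA i j; rewrite mxE normrN. Qed.

Lemma bounded_entriesZ m k (d K : R) (A : 'M[C]_(m, k)) : 0 <= d ->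
  bounded_entries K A -> bounded_entries (d * K) (d%:C *: A).
Proof.
move=> d0 hA i j; rewrite mxE normrM rmorphM /=.
by rewrite (ger0_norm (_ : 0 <= d%:C))// ?ler_wpM2l ?ler0c.
Qed.

Lemma bounded_entriesM m k l (K L : R) (A : 'M[C]_(m, k)) (B : 'M[C]_(k, l)) :
  bounded_entries K A -> bounded_entries L B ->
  bounded_entries (k%:R * (K * L)) (A *m B).
Proof.
move=> hA hB i j; rewrite mxE; apply: (le_trans (ler_norm_sum _ _ _)).
rewrite mulr_natl rmorphMn/= -[k in leRHS]card_ord -sumr_const.
by apply: ler_sum => x _; rewrite normrM rmorphM ler_pM.
Qed.

Lemma bounded_entries_trmxC m k (K : R) (A : 'M[C]_(m, k)) :
  bounded_entries K A -> bounded_entries K (A^t*).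
Proof. by move=> hA i j; rewrite !mxE norm_conjC. Qed.

Lemma bounded_entries_scalar (x : R) : 0 <= x ->
  bounded_entries x ((x%:C)%:M : 'M[C]_N).
Proof.
move=> x0 i j; rewrite !mxE; case: eqP => _; last by rewrite mulr0n normr0 ler0c.
by rewrite mulr1n ger0_norm ?ler0c.
Qed.

Lemma bounded_entries_nrm u (r : R) : 0 <= r -> nrm u <= r ^+ 2 ->
  bounded_entries r u.
Proof.
move=> r0 ur i j; rewrite ord1 -(ler_pXn2r (n := 2))// ?nnegrE ?ler0c//.
rewrite -[leRHS]rmorphXn; apply: (@le_trans _ _ (nrm u)%:C); last by rewrite lecR.
rewrite -nrmE dotmxE mxE (bigD1 j)//= !mxE -normCK lerDl.
by apply: sumr_ge0 => k _; rewrite !mxE -normCK exprn_ge0.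
Qed.

Lemma nbhs_entries (A : 'M[C]_N) (e : R) : 0 < e ->
  nbhs (A : 'M[C^o]_N) [set B : 'M[C]_N | forall i j, `|A i j - B i j| < e%:C].
Proof.
move=> e0; apply/nbhs_ballP; exists e%:C; first by rewrite /= ltcR.
by move=> B [_ h] i j; exact: (h i j).
Qed.

Lemma nbhs_entriesP (A : 'M[C]_N) (U : set 'M[C]_N) : nbhs (A : 'M[C^o]_N) U ->
  exists2 e : R, 0 < e &
    forall B : 'M[C]_N, (forall i j, `|A i j - B i j| < e%:C) -> U B.
Proof.
(* The radius of a ball is a positive element of [C], hence real. *)
move=> /nbhs_ballP[e /= e0 h]; have er : (complex.Re e)%:C = e.
  by rewrite RRe_real// gtr0_real.
exists (complex.Re e); first by rewrite -ltcR er.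
by move=> B hB; apply: h; split => // i j; rewrite -er; exact: hB.
Qed.

(** Three kinds of monotone functions are applied: scalings make [I] a cone, ramps isolate a top
    eigenvalue, and clamps produce range projections. *)
Lemma Iso_scale (c : R) : 0 <= c -> Iso R ( *%R c).
Proof. by move=> c0; split=> [|x y]; [exact: mulrl_continuous | exact: ler_wpM2l]. Qed.

Lemma Iso_ramp (g : R) : Iso R (fun x => Num.max (x - g) 0).
Proof.
split => [x|x y xy]; last first.
  by rewrite ge_max !le_max lerD2r xy lexx orbT.
apply: (@continuous_max _ _ (fun x : R => x - g) (fun=> 0)).
  by apply: continuousB => //; exact: cst_continuous.
exact: cst_continuous.
Qed.

Lemma Iso_clamp (c : R) : 0 <= c -> Iso R (fun x => Num.min (c * x) 1).
Proof.
move=> c0; split => [x|x y xy]; last first.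
  by rewrite le_min !ge_min ler_wpM2l// lexx orbT.
apply: (@continuous_min _ _ (fun x : R => c * x) (fun=> 1)).
  exact: mulrl_continuous.
exact: cst_continuous.
Qed.

Variables (I : set 'M[C]_N) (hI : isocone I).

(* Up to the factor ['[v]], the projection on the line of the row vector [v]. *)
Definition line v := I (v^t* *m v).

Lemma isocone_lim b :
  (forall e : R, 0 < e -> exists2 b', I b' & forall i j, `|b i j - b' i j| < e%:C) ->
  I b.
Proof.
move=> h; apply: (isocone_closed hI) => U /nbhs_entriesP[e e0 eU].
have [b' Ib' bb'] := h e e0.
by exists b'; split => //; exact: eU.
Qed.

Lemma isocone_dense_approx b (e : R) : b \is hermsymmx -> 0 < e ->
  exists b1 b2, [/\ I b1, I b2 & forall i j, `|b i j - (b1 - b2) i j| < e%:C].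
Proof.
move=> bh e0; have : Herm R N b by [].
rewrite -(isocone_dense hI) => /(_ _ (nbhs_entries b e0)).
by move=> [_ [[b1 I1 [b2 I2 <-]] h]]; exists b1, b2.
Qed.

Lemma isocone_hermsym b : I b -> b \is hermsymmx.
Proof. exact: isocone_herm hI b. Qed.

Lemma isoconeZ (c : R) b : 0 <= c -> I b -> I (c%:C *: b).
Proof.
move=> c0 Ib; rewrite -funcalcZ ?isocone_hermsym//.
by apply: (isocone_funcalc hI) => //; exact: Iso_scale.
Qed.

Lemma isocone0 : I 0.
Proof. by have := isocone_scalar hI 0; rewrite -scalemx1 scale0r. Qed.

Lemma isocone_sum (T : Type) (s : seq T) (F : T -> 'M[C]_N) :
  (forall i, I (F i)) -> I (\sum_(i <- s) F i).
Proof.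
by move=> h; elim/big_ind: _ => //; [exact: isocone0 | exact: (isoconeD hI)].
Qed.

Lemma isoconeZ_inv (c : R) b : 0 < c -> I (c%:C *: b) -> I b.
Proof.
move=> c0; have /isoconeZ h : 0 <= c^-1 by rewrite invr_ge0 ltW.
by move=> /h; rewrite scalerA -rmorphM mulVf ?gt_eqF// scale1r.
Qed.

Lemma lineZ (a : C) v : line v -> line (a *: v).
Proof.
rewrite /line trmxCZ -scalemxAl -scalemxAr scalerA mulrC -normCK => h.
have -> : `|a| ^+ 2 = (ComplexField.Normc.normc a ^+ 2)%:C by rewrite rmorphXn.
by apply: isoconeZ => //; rewrite sqr_ge0.
Qed.

(** The ramp starting at [g] leaves only the eigenvalue [l], so it sends [c] to a positive multiple
    of the projection on the line of [u]. *)
Lemma line_top c u (l g : R) : I c -> u != 0 -> u *m c = l%:C *: u -> g < l ->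
  (forall y, '[y, u] = 0 -> '[y *m c, y] <= g%:C * '[y]) -> line u.
Proof.
move=> Ic u0 uc gl yc; have ch := isocone_hermsym Ic.
have n0 : 0 < nrm u by rewrite nrm_gt0.
have nN : (nrm u)%:C != 0 :> C.
  by rewrite -(rmorph0 (real_complex R)) (inj_eq (@complexI R)) gt_eqF.
pose p := ((nrm u)^-1)%:C *: (u^t* *m u).
have ph : p \is hermsymmx by rewrite hermZ ?herm_rank1.
have pp : p *m p = p.
  rewrite /p -scalemxAl -scalemxAr -!mulmxA mul_rank1 -scalemxAr nrmE.
  by rewrite !scalerA -rmorphM mulVf ?gt_eqF// mulr1.
have := isocone_funcalc hI Ic (Iso_ramp g).
rewrite (funcalc_top ch ph pp _ gl) => [||y]; last 2 first.
- by rewrite /p -scalemxAl -mulmxA uc -scalemxAr !scalerA mulrC.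
- rewrite /p -scalemxAr mul_rank1 scalerA => /eqP.
  rewrite scaler_eq0 (negbTE u0) orbF fmorphV mulf_eq0 invr_eq0 (negbTE nN) /=.
  by move=> /eqP; exact: yc.
rewrite /p scalerA -rmorphM => /isoconeZ_inv; apply.
by rewrite mulr_gt0 ?subr_gt0 ?invr_gt0.
Qed.

Lemma line_lim v n :
  (forall d : R, 0 < d -> d < 1 -> line (v + d%:C *: n)) -> line v.
Proof.
move=> h; apply: isocone_lim => e e0.
have [K K0 hK] := bounded_entries_ex (v^t* *m n + n^t* *m v).
have [L L0 hL] := bounded_entries_ex (n^t* *m n).
(* The two rank one matrices differ entrywise by at most [d (K + d L) <= d (K + L) < e]; the summand
   [e] in the denominator ensures [d < 1]. *)
pose d := e / (2 * (K + L + e)).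
have D0 : 0 < 2 * (K + L + e) by lra.
have d0 : 0 < d by rewrite divr_gt0.
have d1 : d < 1 by rewrite ltr_pdivrMr// mul1r; lra.
exists ((v + d%:C *: n)^t* *m (v + d%:C *: n)); first exact: h.
move=> i j.
have dE : (v + d%:C *: n)^t* *m (v + d%:C *: n) =
  v^t* *m v + d%:C *: ((v^t* *m n + n^t* *m v) + d%:C *: (n^t* *m n)).
  rewrite trmxCD trmxCZ conj_real mulmxDl !mulmxDr -!scalemxAl -!scalemxAr.
  move: (v^t* *m v) (v^t* *m n) (n^t* *m v) (n^t* *m n) => A1 A2 A3 A4.
  by rewrite -addrA -!scalerDr addrA.
have sub (A B : 'M[C]_N) : A i j - (A + B) i j = - B i j.
  by rewrite mxE opprD addNKr.
rewrite dE sub normrN.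
have := bounded_entriesZ (ltW d0) (bounded_entriesD hK (bounded_entriesZ (ltW d0) hL)).
move=> /(_ i j) /le_lt_trans; apply; rewrite ltcR.
have : d * (K + d * L) <= d * (K + L).
  by apply: ler_wpM2l (ltW d0) _ _ _; rewrite lerD2l ger_pMl// ltW.
move=> /le_lt_trans; apply; rewrite /d mulrAC ltr_pdivrMr// ltr_pM2l//; lra.
Qed.

End Cone.

(** * Range projections, and the projection of a line on a plane *)

Section Projection.
Set Implicit Arguments.
Unset Strict Implicit.
Variables (R : realType) (N : nat).
Local Notation C := R[i].
Implicit Types (b p q : 'M[C]_N) (u v w x y z n : 'rV[C]_N).
Variables (I : set 'M[C]_N) (hI : isocone I).

(** The final estimate of [line_proj], with [t] standing for the squared modulus of ['[z, n]]. The
    left side simplifies to [d (1 - d) t / (nv + d nn)], and [d nn] is at most the denominator. *)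
Lemma perturbation_le (d nv nn nz t : R) : 0 < d -> d < 1 -> 0 < nv -> 0 <= nn ->
  0 <= nz -> t <= nz * nn ->
  d * (1 - d)^-1 / (nv + d * nn) * ((1 - d) ^+ 2 * t) <= nz.
Proof.
move=> d0 d1 nv0 nn0 nz0 tn; have dn0 : 0 <= d * nn by rewrite mulr_ge0// ltW.
have m0 : 0 < nv + d * nn by exact: ltr_pwDl.
have d1' : 0 < 1 - d by rewrite subr_gt0.
have -> : d * (1 - d)^-1 / (nv + d * nn) * ((1 - d) ^+ 2 * t) =
  d * (1 - d) * t / (nv + d * nn) by field; rewrite !gt_eqF.
rewrite ler_pdivrMr//; apply: (@le_trans _ _ (d * (1 - d) * (nz * nn))).
  by rewrite ler_wpM2l// mulr_ge0 ?ltW.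
have -> : d * (1 - d) * (nz * nn) = nz * (d * nn * (1 - d)) by ring.
apply: ler_wpM2l => //; apply: (@le_trans _ _ (d * nn)); last by rewrite lerDr ltW.
by rewrite ler_piMr// gerBl ltW.
Qed.

Lemma row_unitary_nrm (P : 'M[C]_N) j : P \is unitarymx -> '[row j P] = 1.
Proof. by move=> /row_unitarymxP ->; rewrite eqxx. Qed.

Lemma conj_diag_mul (P : 'M[C]_N) (d e : 'rV[R]_N) : P \is unitarymx ->
  conj_diag P d *m conj_diag P e = conj_diag P (\row_j (d 0 j * e 0 j)).
Proof.
move=> /unitarymxP Pu.
have -> : conj_diag P d *m conj_diag P e =
   P^t* *m (diag_mx (\row_j (d 0 j)%:C) *m diag_mx (\row_j (e 0 j)%:C)) *m P.
  by rewrite /conj_diag !mulmxA -(mulmxA _ P (P^t*)) Pu mulmx1.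
rewrite mulmx_diag /conj_diag.
suff -> : \row_j ((\row_j (d 0 j)%:C) 0 j * (\row_j (e 0 j)%:C) 0 j) =
  \row_j ((\row_j (d 0 j * e 0 j)) 0 j)%:C :> 'rV[C]_N by [].
by apply/rowP => j; rewrite !mxE -rmorphM.
Qed.

(** Clamping at 1 a large multiple of [b] turns all nonzero eigenvalues into 1 and keeps 0, which
    gives the range projection of [b]. *)
Lemma isocone_range_proj b : I b -> (forall y, 0 <= '[y *m b, y]) ->
  exists q, [/\ I q, q *m q = q, b *m q = b &
    forall x, x *m b = 0 -> x *m q = 0].
Proof.
move=> Ib b0; have bh := isocone_hermsym hI Ib.
have [P [d [Pu bE]]] := spectralP bh.
have d0 j : 0 <= d 0 j.
  have := b0 (row j P); rewrite bE row_conj_diag// dotZl.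
  by rewrite row_unitary_nrm// mulr1 ler0c.
(* [K] dominates the inverse of each nonzero eigenvalue; zero eigenvalues contribute [0^-1 = 0]. *)
pose K := \sum_j (d 0 j)^-1.
have K0 : 0 <= K by apply: sumr_ge0 => j _; rewrite invr_ge0.
pose phi (r : R) := Num.min (K * r) 1.
have phi0 : phi 0 = 0 by rewrite /phi mulr0 min_l.
have phi1 j : phi (d 0 j) = (d 0 j != 0)%:R.
  have [->//|dj] := eqVneq (d 0 j) 0.
  have dj0 : 0 < d 0 j by rewrite lt0r dj d0.
  rewrite /phi min_r// -ler_pdivrMr// mul1r /K (bigD1 j)//= lerDl.
  by apply: sumr_ge0 => k _; rewrite invr_ge0.
have qE : funcalc phi b = conj_diag P (map_mx phi d).
  by rewrite bE (funcalc_conj_diag phi d Pu).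
exists (funcalc phi b); split.
- by have := isocone_funcalc hI Ib (Iso_clamp K0).
- rewrite qE (conj_diag_mul _ _ Pu); apply: congr1.
  by apply/rowP => j; rewrite !mxE phi1; case: (_ != _); rewrite ?mulr1 ?mulr0.
- rewrite qE bE (conj_diag_mul _ _ Pu); apply: congr1.
  by apply/rowP => j; rewrite !mxE phi1; case: eqVneq => [->|]; rewrite ?mulr1 ?mulr0.
move=> x xb; have := @funcalc_eigen _ _ phi b _ x 0 bh.
by rewrite phi0 !scale0r => ->.
Qed.

(* As [d] tends to 0, [v + d n] is the top eigenvector of [q] perturbed by a
   small multiple of the rank one matrix of [v + n]. *)
Lemma line_proj q v n : I q -> q *m q = q -> v *m q = v -> n *m q = 0 ->
  line I (v + n) -> line I v.
Proof.
move=> Iq qq vq nq vnl; have qh := isocone_hermsym hI Iq.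
have [v0|v0] := eqVneq v 0; first by rewrite v0 /line mulmx0; exact: isocone0 hI.
apply: (line_lim hI (n := n)) => d d0 d1.
have vn : '[v, n] = 0 by rewrite -vq (dot_herm _ _ qh) nq dot0r.
have nv := dot_eq0C vn.
have nv0 : 0 < nrm v by rewrite nrm_gt0.
have nn0 := nrm_ge0 n.
pose m := nrm v + d * nrm n.
have m0 : 0 < m := ltr_pwDl nv0 (mulr_ge0 (ltW d0) nn0).
have d1' : 0 < 1 - d by rewrite subr_gt0.
(* The vector [v + d n] is sent by [c] to [v + e m (v + n)]. This is [l (v + d n)] when [e m = d l]
   and [1 + d l = l], which determines [l] and [e]. *)
pose l := (1 - d)^-1; pose e := d * l / m.
have e0 : 0 < e by rewrite divr_gt0// mulr_gt0// invr_gt0.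
have em : e * m = d * l by rewrite /e mulfVK// gt_eqF.
have ldE : 1 + d * l = l by rewrite /l; field; rewrite gt_eqF.
pose c := q + e%:C *: ((v + n)^t* *m (v + n)).
have un : '[v + d%:C *: n, v + n] = m%:C.
  rewrite dotDl !dotDr !dotZl vn nv mulr0 addr0 add0r !nrmE.
  by rewrite -rmorphM -rmorphD.
apply: (@line_top _ _ _ hI c (v + d%:C *: n) l 1).
- apply: (isoconeD hI) => //; apply: (isoconeZ hI) => //; exact: ltW.
- apply/eqP => /(congr1 (fun x => '[x, v + n])); rewrite un dot0l => /eqP.
  by rewrite -(rmorph0 (real_complex R)) (inj_eq (@complexI R)) gt_eqF.
- rewrite /c mulmxDr -scalemxAr mul_rank1 un mulmxDl vq -scalemxAl nq scaler0 addr0.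
  rewrite scalerA -rmorphM em scalerDr addrA -{1}[v]scale1r -scalerDl.
  rewrite -[1](rmorph1 (real_complex R)) -rmorphD ldE scalerDr scalerA.
  by rewrite -rmorphM [l * d]mulrC.
- by rewrite /l (invf_gt1 d1') gtrBl.
(* For [y] orthogonal to [v + d n], the rank one term sees only the part [z] of [y] off [q], because
   ['[y, v + n] = (1 - d) '[z, n]]. By Cauchy-Schwarz it adds at most [nrm z] to [nrm (y *m q)],
   whence the bound 1 on the other eigenvalues. *)
move=> y yu; pose z := y - y *m q.
have zq : z *m q = 0 by rewrite mulmxBl -mulmxA qq subrr.
have yqz : '[y *m q, z] = 0 by rewrite (dot_herm _ _ qh) zq dot0r.
have yE : y = y *m q + z by rewrite addrC subrK.
have yn : '[y, n] = '[z, n].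
  by rewrite {1}yE dotDl (dot_herm _ _ qh) nq dot0r add0r.
have yvn : '[y, v + n] = (1 - d)%:C * '[z, n].
  have : '[y, v] + d%:C * '[y, n] = 0.
    by rewrite -[RHS]yu dotDr dotZr.
  rewrite yn => /eqP; rewrite addr_eq0 => /eqP yv.
  by rewrite dotDr yn yv rmorphB rmorph1 mulrBl mul1r addrC.
have -> : '[y *m c, y] = (nrm (y *m q))%:C + e%:C * `|'[y, v + n]| ^+ 2.
  rewrite /c mulmxDr dotDl -{1}qq mulmxA (dot_herm _ _ qh) nrmE; congr (_ + _).
  rewrite -scalemxAr mul_rank1 !dotZl normCK.
  by rewrite -(dotC (v + n) y).
have zn : ComplexField.Normc.normc '[z, n] ^+ 2 <= nrm z * nrm n.
  rewrite -lecR rmorphXn [leRHS]rmorphM -[X in _ <= X * _]nrmE -[X in _ <= _ * X]nrmE.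
  exact: (CauchySchwarz (@dotmx C N) z n).
have nyE : nrm y = nrm (y *m q) + nrm z by rewrite {1}yE (nrmD yqz).
rewrite rmorph1 mul1r nrmE nyE yvn normrM exprMn.
have -> : `|(1 - d)%:C| ^+ 2 = ((1 - d) ^+ 2)%:C :> C.
  by rewrite ger0_norm ?rmorphXn// ler0c ltW.
have -> : `|'[z, n]| ^+ 2 = (ComplexField.Normc.normc '[z, n] ^+ 2)%:C.
  by rewrite rmorphXn.
rewrite -!rmorphM -rmorphD lecR lerD2l.
exact: (perturbation_le d0 d1 nv0 nn0 (nrm_ge0 z) zn).
Qed.

(** The range projection of the sum of the rank one matrices of [x] and [y] lies in [I], fixes [x]
    and [y] and kills [n], so [line_proj] applies. *)
Lemma line_plane x y (a b : C) n : line I x -> line I y ->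
  '[n, x] = 0 -> '[n, y] = 0 -> line I (a *: x + b *: y + n) ->
  line I (a *: x + b *: y).
Proof.
move=> lx ly nx ny.
pose c := x^t* *m x + y^t* *m y.
have cE z : z *m c = '[z, x] *: x + '[z, y] *: y by rewrite mulmxDr !mul_rank1.
have cn z : '[z *m c, z] = `|'[z, x]| ^+ 2 + `|'[z, y]| ^+ 2.
  by rewrite cE dotDl (dotZl _ x) (dotZl _ y) (dot_mulC z x) (dot_mulC z y).
have [q [Iq qq cq qn]] : exists q, [/\ I q, q *m q = q, c *m q = c &
    forall x, x *m c = 0 -> x *m q = 0].
  apply: isocone_range_proj; first exact: isoconeD hI _ _ lx ly.
  by move=> z; rewrite cn addr_ge0// exprn_ge0.
have qh := isocone_hermsym hI Iq.
have ch : c \is hermsymmx := hermD (herm_rank1 x) (herm_rank1 y).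
suff [xq yq] : x *m q = x /\ y *m q = y.
  apply: (line_proj Iq qq); first by rewrite mulmxDl -!scalemxAl xq yq.
  by apply: qn; rewrite cE nx ny !scale0r addr0.
(* The part [k z] of [z] off [q] is killed by [c], hence orthogonal to [x] and [y]. For [z = x] or
   [z = y] this says that [k z] has norm 0. *)
pose k z := z - z *m q.
have kd z w : '[k z, w] = '[k z, k w].
  have kq : '[k z, w *m q] = 0.
    by rewrite -(dot_herm _ _ qh) /k mulmxBl -mulmxA qq subrr dot0l.
  by rewrite [k w]/k dotBr kq subr0.
have kc z : k z *m c = 0.
  have qc : q *m c = c.
    have /(congr1 (fun X => X^t*)) := cq.
    by rewrite trmxC_mul (herm_trmxC qh) (herm_trmxC ch).
  by rewrite /k mulmxBl -mulmxA qc subrr.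
have kz z : '[k z, x] = 0 /\ '[k z, y] = 0.
  have := cn (k z); rewrite kc dot0l => /esym/eqP.
  move: '[k z, x] '[k z, y] => r s; rewrite paddr_eq0 ?exprn_ge0//.
  by rewrite !sqrf_eq0 !normr_eq0 => /andP[/eqP-> /eqP->].
have k0 z : '[k z, z] = 0 -> z *m q = z.
  rewrite kd => /eqP; rewrite dnorm_eq0 subr_eq0 => /eqP h; exact/esym.
by split; apply: k0; have [] := kz x; have [] := kz y.
Qed.

End Projection.

(** * Enlarging a cap to the whole space in dimension at least 3 *)

Section Expansion.
Set Implicit Arguments.
Unset Strict Implicit.
Variables (R : realType) (N : nat).
Local Notation C := R[i].
Implicit Types (b p q : 'M[C]_N) (u v w x y z n : 'rV[C]_N).

(** Two linear conditions leave a nonzero solution in dimension at least 3; rescaling adjusts its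
    norm. *)
Lemma exists_orthogonal u v (s : R) : (3 <= N)%N -> 0 <= s ->
  exists e, [/\ '[e, u] = 0, '[e, v] = 0 & nrm e = s].
Proof.
move=> N3 s0; pose A : 'M[C]_(N, 1 + 1) := row_mx (u^t*) (v^t*).
have kA : kermx A != 0.
  rewrite -mxrank_eq0 mxrank_ker -lt0n subn_gt0.
  by apply: leq_ltn_trans (rank_leq_col A) _.
pose e := nz_row (kermx A).
have e0 : e != 0 by rewrite nz_row_eq0.
have eA : e *m A = 0.
  by apply/eqP; rewrite -sub_kermx; exact: nz_row_sub.
have [eu ev] : '[e, u] = 0 /\ '[e, v] = 0.
  move: eA; rewrite mul_mx_row -row_mx0 => /eq_row_mx[eu ev].
  by rewrite !dotmxE eu ev mxE.
have ne : 0 < nrm e by rewrite nrm_gt0.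
exists ((Num.sqrt (s / nrm e))%:C *: e); split.
- by rewrite dotZl eu mulr0.
- by rewrite dotZl ev mulr0.
apply: (@complexI R); rewrite -nrmE dotZl dotZr nrmE -!rmorphM; congr (_%:C).
rewrite mulrA -expr2 sqr_sqrtr; last exact: divr_ge0 (ltW ne).
by rewrite mulfVK// gt_eqF.
Qed.

Variables (I : set 'M[C]_N) (hI : isocone I) (N3 : (3 <= N)%N).

(* The lines within angle [atan (x ^ (-1/2))] of [u] all belong to [I]. *)
Definition cap u (x : R) := forall y, '[y, u] = 0 -> nrm y * x <= 1 -> line I (u + y).

(* Spherical Thales: for [e] orthogonal to [u] and [y], the plane spanned by
   [u + e] and [u + y] meets the cap, and [u - e] projects in it onto a multiple
   of [u + y] as soon as [1 - |e|^2 = 1 / (1 + |y|^2)]; then [|y| > |e|]. *)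
Lemma cap_expand u (x : R) : nrm u = 1 -> 0 <= x -> cap u (x + 1) -> cap u x.
Proof.
move=> u1 x0 hc y yu yx; have uy := dot_eq0C yu.
pose t := nrm y; have t0 : 0 <= t := nrm_ge0 y.
have t1 : 0 < 1 + t by exact: ltr_pwDl.
(* With this [c], the vector [c (u + y)] is the projection of [u - e] on the line of [u + y]; with
   [nrm e = s = 1 - c], the remainder [n] is orthogonal to [u + e] too. *)
pose c := (1 + t)^-1; have c0 : 0 < c by rewrite invr_gt0.
have ct : c * (1 + t) = 1 by rewrite mulVf ?gt_eqF.
pose s := 1 - c.
have sE : s = t * c by rewrite /s -ct; ring.
have s0 : 0 <= s by rewrite sE mulr_ge0// ltW.
(* For [t > 0] one has [1 / s = 1 / t + 1], so [t x <= 1] amounts to [s (x + 1) <= 1]. *)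
have sx : s * (x + 1) <= 1.
  rewrite sE mulrAC /c ler_pdivrMr// mul1r mulrDr mulr1 lerD2r.
  exact: yx.
have [e [eu ey es]] := exists_orthogonal u y N3 s0.
have ue := dot_eq0C eu; have ye := dot_eq0C ey.
have u1' : '[u] = 1 by rewrite nrmE u1 rmorph1.
have la : line I (u + e) by apply: hc; rewrite ?es.
have lu : line I (u - e).
  apply: hc; first by rewrite -[- e]sub0r dotBl dot0l eu subr0.
  by rewrite /nrm hnormN -/(nrm e) es.
(* A second line [a] of the plane is needed inside the cap. Since [d t = 2 s], rescaling [a] to
   [u + (e + d y) / (1 + d)] gives the squared radius [s (1 + 2 d) / (1 + d)^2 <= s]. *)
pose d := 2 * c.
have d1 : 0 < 1 + d by rewrite addr_gt0// mulr_gt0.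
pose a := u + e + d%:C *: (u + y).
have lb : line I a.
  have -> : a = (1 + d)%:C *: (u + ((1 + d)^-1)%:C *: (e + d%:C *: y)).
    rewrite scalerDr scalerA -rmorphM (mulfV (lt0r_neq0 d1)) rmorph1 scale1r.
    by rewrite rmorphD rmorph1 scalerDl scale1r /a scalerDr addrACA.
  apply: lineZ => //; apply: hc.
    by rewrite dotZl dotDl dotZl eu yu mulr0 addr0 mulr0.
  rewrite (_ : nrm _ = (1 + d)^-1 ^+ 2 * (s + d ^+ 2 * t)); last first.
    apply: (@complexI R); rewrite -nrmE dotZl dotZr dotDl !dotDr !dotZl !dotZr ey ye.
    rewrite !nrmE es -/t !mulr0 addr0 add0r -!rmorphM -rmorphD -!rmorphM.
    by congr (_%:C); ring.
  apply: le_trans sx; apply: ler_wpM2r; first by rewrite addr_ge0.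
  rewrite exprVn mulrC ler_pdivrMr ?exprn_gt0//.
  have -> : d ^+ 2 * t = 2 * d * s by rewrite sE /d; ring.
  have sq (r k : R) : 0 <= r -> r + 2 * k * r <= r * (1 + k) ^+ 2.
    move=> r0; have -> : r * (1 + k) ^+ 2 = r + 2 * k * r + r * k ^+ 2 by ring.
    by rewrite lerDl mulr_ge0 ?sqr_ge0.
  exact: sq.
pose n := u - e - c%:C *: (u + y).
have nw : '[n, u + y] = 0.
  rewrite /n !dotBl dotZl !dotDl !dotDr uy yu eu ey u1' [in '[y]]nrmE -/t.
  rewrite !addr0 subr0 add0r -(rmorph1 (real_complex R)) -rmorphD -rmorphM ct.
  exact: subrr.
have na : '[n, u + e] = 0.
  rewrite /n !dotBl dotZl !dotDl !dotDr ue yu eu ye u1' [in '[e]]nrmE es.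
  rewrite !addr0 add0r mulr1 -(rmorph1 (real_complex R)) -!rmorphB /s.
  by rewrite (_ : _ - _ - _ = 0) ?rmorph0//; ring.
have nb : '[n, a] = 0 by rewrite /a dotDr dotZr na nw mulr0 addr0.
have vE : c%:C *: (u + y) = (- 2^-1)%:C *: (u + e) + (2^-1)%:C *: a.
  rewrite /a; move: (u + e) (u + y) => A B.
  by rewrite rmorphN scaleNr (scalerDr _ A) addKr scalerA -rmorphM /d mulKf.
have lv : line I (c%:C *: (u + y)).
  rewrite vE; apply: (line_plane hI la lb na nb); rewrite -vE.
  by rewrite /n addrC subrK.
have := lineZ hI ((1 + t)%:C) lv.
by rewrite scalerA -rmorphM mulrC ct rmorph1 scale1r.
Qed.

(** After [k] expansions the condition on [nrm y] is void, and each [v] not orthogonal to [u] is a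
    multiple of some [u + y]. An orthogonal [v] is the limit of [v + d u]. *)
Lemma cap_line u (k : nat) : nrm u = 1 -> cap u k%:R -> forall v, line I v.
Proof.
move=> u1 ck; have c0 : cap u 0.
  elim: k ck => [//|k IHk] ck; apply: IHk; apply: cap_expand => //.
  by rewrite natr1.
have u1' : '[u] = 1 by rewrite nrmE u1 rmorph1.
have gen v : '[v, u] != 0 -> line I v.
  move=> vu; have -> : v = '[v, u] *: (u + ('[v, u]^-1 *: v - u)).
    by rewrite addrC subrK scalerA mulfV// scale1r.
  apply: (lineZ hI); apply: c0; last by rewrite mulr0.
  by rewrite dotBl dotZl mulVf// u1' subrr.
move=> v; have [vu|] := eqVneq '[v, u] 0; last exact: gen.
apply: (line_lim hI (n := u)) => d d0 _; apply: gen.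
rewrite dotDl dotZl vu u1' add0r mulr1 -(rmorph0 (real_complex R)).
by rewrite (inj_eq (@complexI R)) gt_eqF.
Qed.

(** Adding a large scalar makes all eigenvalues nonnegative, so the spectral decomposition is a
    combination inside the cone; the scalar is then subtracted within [I]. *)
Lemma line_herm : (forall v, line I v) -> I = Herm R N.
Proof.
move=> hl; apply/seteqP; split=> [b /(isocone_hermsym hI)//|b /= bh].
have [P [d [Pu ->]]] := spectralP bh.
pose K := \sum_j `|d 0 j|.
have -> : conj_diag P d = conj_diag P (d + const_mx K) + ((- K)%:C)%:M.
  rewrite -[d in LHS](addrK (const_mx K)) -conj_diagB (conj_diag_const _ Pu).
  by rewrite rmorphN -[in RHS]scalemx1 scaleNr scalemx1.
apply: (isoconeD hI); last exact: isocone_scalar hI _.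
rewrite conj_diagE; apply: (isocone_sum hI) => j.
apply: (isoconeZ hI); last exact: hl.
rewrite 2!mxE -lerBlDl sub0r; apply: (@le_trans _ _ `|d 0 j|).
  by rewrite -normrN ler_norm.
by rewrite /K (bigD1 j)//= lerDl sumr_ge0.
Qed.

End Expansion.

(** * An interior point of the isocone, and a first cap *)

Section Interior.
Set Implicit Arguments.
Unset Strict Implicit.
Variables (R : realType) (N : nat).
Local Notation C := R[i].
Implicit Types (b c p q : 'M[C]_N) (u v w x y z : 'rV[C]_N).

Lemma scalar_bounded (f : 'M[C]_N -> C) : scalar f ->
  exists2 K : R, 0 < K &
    forall (e : R) b, 0 <= e -> bounded_entries e b -> `|f b| <= (K * e)%:C.
Proof.
move=> fl; pose F : {scalar 'M[C]_N} := HB.pack f (GRing.isLinear.Build _ _ _ _ f fl).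
pose A : 'M[C]_N := \matrix_(i, j) F (delta_mx i j).
exists (1 + \sum_i \sum_j ComplexField.Normc.normc (A i j)) => [|e b ee be].
  rewrite ltr_pwDl// sumr_ge0// => i _.
  by rewrite sumr_ge0// => j _; exact: normc_ge0.
have -> : f b = \sum_i \sum_j b i j * A i j.
  rewrite -[f]/(F : _ -> _) [b in LHS]matrix_sum_delta linear_sum.
  apply: eq_bigr => i _; rewrite linear_sum.
  by apply: eq_bigr => j _; rewrite linearZ mxE.
apply: (@le_trans _ _ (\sum_i \sum_j (ComplexField.Normc.normc (A i j) * e)%:C)).
  apply: (le_trans (ler_norm_sum _ _ _)); apply: ler_sum => i _.
  apply: (le_trans (ler_norm_sum _ _ _)); apply: ler_sum => j _.
  by rewrite normrM mulrC rmorphM ler_wpM2l.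
have -> : \sum_i \sum_j (ComplexField.Normc.normc (A i j) * e)%:C =
    ((\sum_i \sum_j ComplexField.Normc.normc (A i j)) * e)%:C.
  rewrite mulr_suml rmorph_sum; apply: eq_bigr => i _.
  by rewrite mulr_suml rmorph_sum.
by rewrite lecR mulrDl mul1r lerDr.
Qed.

Variables (I : set 'M[C]_N) (hI : isocone I).

(** A finite family in [I] whose complex span has maximal dimension: no element of [I] can enlarge
    that span. *)
Lemma isocone_span : exists X : seq 'M[C]_N,
  (forall b, b \in X -> I b) /\ (forall b, I b -> b \in <<X>>%VS).
Proof.
pose P k := `[< exists X : seq 'M[C]_N, (forall b, b \in X -> I b) /\ \dim <<X>> = k >].
have P0 : exists k, P k.
  by exists (\dim <<[::] : seq 'M[C]_N>>); apply/asboolP; exists [::].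
have Pb k : P k -> (k <= \dim {: 'M[C]_N})%N.
  by move=> /asboolP[X [_ <-]]; exact/dimvS/subvf.
case: (ex_maxnP P0 Pb) => k /asboolP[X [XI Xk]] kmax.
exists X; split => // b Ib.
have sX : (<<X>> <= <<b :: X>>)%VS by rewrite span_cons addvSr.
have : (\dim <<b :: X>> <= \dim <<X>>)%N.
  rewrite Xk; apply: kmax; apply/asboolP; exists (b :: X); split => // a.
  by rewrite inE => /orP[/eqP->//|]; exact: XI.
move=> dl; have /eqP -> : <<X>>%VS == <<b :: X>>%VS by rewrite eqEdim sX.
by apply: memv_span; rewrite inE eqxx.
Qed.

(** The span is the kernel of the linear map [L], whose entries are bounded functionals. It contains
    the differences from [I], and these approximate every hermitian matrix. *)
Lemma herm_span (X : seq 'M[C]_N) : (forall b, I b -> b \in <<X>>%VS) ->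
  forall b, b \is hermsymmx -> b \in <<X>>%VS.
Proof.
move=> IX b bh; pose c i a := coord (in_tuple X) i a.
pose L a := a - \sum_i c i a *: (in_tuple X)`_i.
have L0 a : a \in <<X>>%VS -> L a = 0.
  by move=> aX; rewrite /L -(coord_span (X := in_tuple X) aX) subrr.
have Ll k a a' : L (k *: a + a') = k *: L a + L a'.
  rewrite /L scalerBr addrACA -opprD; congr (_ - _).
  rewrite scaler_sumr -big_split; apply: eq_bigr => i _ /=.
  by rewrite /c linearP scalerDl scalerA.
suff Lb : L b = 0.
  rewrite -[b](subrK (\sum_i c i b *: (in_tuple X)`_i)) -/(L b) Lb add0r.
  by apply: memv_suml => i _; apply/memvZ/memv_span/mem_nth.
clearbody L; apply/matrixP => i j; rewrite [RHS]mxE; apply/eqP; rewrite -normr_le0.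
have [|K K0 hK] := @scalar_bounded (fun a => L a i j).
  by move=> k a a'; rewrite Ll mxE [X in X + _]mxE.
have nE : `|L b i j| = (ComplexField.Normc.normc (L b i j))%:C by [].
rewrite nE -(rmorph0 (real_complex R)) lecR; apply/ler_addgt0Pr => e e0.
rewrite add0r.
have [b1 [b2 [I1 I2 hb]]] := isocone_dense_approx hI bh (divr_gt0 e0 K0).
have Lw : L (b1 - b2) = 0 by apply/L0/memvB; exact: IX.
have <- : L (b - (b1 - b2)) = L b.
  by have := Ll 1 (b - (b1 - b2)) (b1 - b2); rewrite !scale1r subrK Lw addr0.
have Ke : K * (e / K) = e by rewrite mulrC divfK ?gt_eqF.
have := hK (e / K) (b - (b1 - b2)) (ltW (divr_gt0 e0 K0)).
rewrite Ke => hh; rewrite -lecR; apply: hh => k l.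
by rewrite mxE [X in _ + X]mxE ltW.
Qed.

(* If the [X_i] in [I] span, the interior point is their sum: a small hermitian
   matrix is a real combination of the [X_i] with coefficients at least [-1]. *)
Lemma isocone_interior : exists b (e : R), [/\ I b, 0 < e &
  forall c, c \is hermsymmx -> bounded_entries e c -> I (b + c)].
Proof.
have [X [XI IX]] := isocone_span; have hX := herm_span IX.
have XIi (i : 'I_(size X)) : I (in_tuple X)`_i by apply/XI/mem_nth.
pose f i a := coord (in_tuple X) i a.
have /choice[K hK] i : exists K : R, 0 < K /\
    forall (e : R) b, 0 <= e -> bounded_entries e b -> `|f i b| <= (K * e)%:C.
  by have [K ? ?] := @scalar_bounded (f i) (linearP _); exists K.
pose S := 1 + \sum_i K i.
have K0 i : 0 <= K i by rewrite ltW//; have [] := hK i.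
have S0 : 0 < S by rewrite ltr_pwDl// sumr_ge0.
have KS i : K i <= S.
  by rewrite /S (bigD1 i)//= addrCA lerDl addr_ge0// sumr_ge0.
exists (\sum_(i < size X) (in_tuple X)`_i), S^-1; split.
- exact: isocone_sum hI _ _ _ XIi.
- by rewrite invr_gt0.
move=> c ch cb.
have f1 i : `|f i c| <= 1.
  have [_ hKi] := hK i; apply: (le_trans (hKi S^-1 c _ cb)).
    by rewrite invr_ge0 ltW.
  by rewrite -(rmorph1 (real_complex R)) lecR ler_pdivrMr// mul1r.
(* [X] may fail to be free, so the coordinates of [c] need not be real. All matrices being
   hermitian, averaging the expansion with its adjoint replaces coordinates by their real parts. *)
have cE : c = \sum_(i < size X) (complex.Re (f i c))%:C *: (in_tuple X)`_i.
  have h := coord_span (X := in_tuple X) (hX c ch).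
  have hc : c = \sum_(i < size X) Num.conj (f i c) *: (in_tuple X)`_i.
    rewrite -[LHS](herm_trmxC ch) {1}h trmxC_sum; apply: eq_bigr => i _.
    by rewrite trmxCZ (herm_trmxC (isocone_hermsym hI (XIi i))).
  have two : 2 != 0 :> C by rewrite pnatr_eq0.
  apply: (scalerI two); rewrite scaler_nat mulr2n (congr2 +%R h hc) -big_split.
  rewrite scaler_sumr; apply: eq_bigr => i _ /=.
  by rewrite -scalerDl scalerA; congr (_ *: _); exact: addcJ.
rewrite {1}cE -big_split /=; apply: (isocone_sum hI) => i.
rewrite -{1}[_`_i]scale1r -(rmorph1 (real_complex R)) -scalerDl -rmorphD.
apply: (isoconeZ hI) => //; rewrite -lerBlDl sub0r.
have : `|complex.Re (f i c)| <= 1.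
  by rewrite -lecR; exact: le_trans (normc_ge_Re _) (f1 i).
by rewrite ler_norml => /andP[].
Qed.

Lemma top_eigenvector b : (0 < N)%N -> b \is hermsymmx ->
  exists u (l : R), [/\ nrm u = 1, u *m b = l%:C *: u &
    forall y, '[y *m b, y] <= l%:C * '[y]].
Proof.
move=> N0 bh; have [P [d [Pu ->]]] := spectralP bh.
pose j := [arg max_(j > Ordinal N0) d 0 j]%O.
have dj k : d 0 k <= d 0 j by rewrite /j; case: arg_maxP => // i _; exact.
exists (row j P), (d 0 j); split; first 2 last.
- move=> y; rewrite -subr_ge0 -dotZl -dotBl -mul_mx_scalar -mulmxBr.
  rewrite -(conj_diag_const _ Pu) conj_diagB; apply: conj_diag_ge0 => k.
  by rewrite !mxE subr_ge0.
- by apply: (@complexI R); rewrite -nrmE row_unitary_nrm.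
- exact: row_conj_diag.
Qed.

(** The entry bound for the perturbation in [isocone_cap], where [x] is [N], [B] bounds [b] and
    [4 r] bounds [D]. The rank one term takes half of [e], the terms in [D] the other half. *)
Lemma cap_bound (x B r e : R) : 0 <= x -> 0 <= B -> 0 <= r -> r <= 1 ->
  r * (B * (8 * x + 16 * x ^+ 2)) <= e / 2 ->
  e / 8 * (2 * 2) + (x * (4 * r * B) + x * (B * (4 * r)) +
    x * (x * (4 * r * B) * (4 * r))) <= e.
Proof.
move=> x0 B0 r0 r1 rM; have rr : r * r <= r by rewrite ler_piMr.
have : r * r * (16 * B * x ^+ 2) <= r * (16 * B * x ^+ 2).
  by rewrite ler_wpM2r// !mulr_ge0 ?sqr_ge0.
lra.
Qed.

Lemma mulmx_compress p c b : p *m b = b -> b *m p = b ->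
  (p + c) *m b *m (p + c) = b + (c *m b + b *m c + c *m b *m c).
Proof.
move=> pb bp; rewrite mulmxDl pb mulmxDr !mulmxDl bp -(mulmxA c b p) bp.
by rewrite !addrA.
Qed.

(** For [u] near the top eigenvector [u0] of an interior point, a small perturbation stays in [I]
    and has [u] as isolated top eigenvector; [line_top] then gives the line of [u]. *)
Lemma isocone_cap : (0 < N)%N -> exists u (k : nat), nrm u = 1 /\ cap I u k%:R.
Proof.
move=> N0; have [b0 [e [Ib0 e0 hb0]]] := isocone_interior.
have [u0 [l [u1 ub0 b0l]]] := top_eigenvector N0 (isocone_hermsym hI Ib0).
(* Moving the top eigenvalue to 0 makes [b] nonpositive, and any compression [T *m b *m T] by a
   hermitian [T] remains so. *)
pose b := b0 + ((- l)%:C)%:M.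
have Ib : I b by apply: (isoconeD hI) => //; exact: isocone_scalar hI _.
have bh := isocone_hermsym hI Ib.
have hb c : c \is hermsymmx -> bounded_entries e c -> I (b + c).
  move=> ch cb; rewrite /b addrAC; apply: (isoconeD hI); first exact: hb0.
  exact: isocone_scalar hI _.
have ub : u0 *m b = 0.
  by rewrite mulmxDr ub0 mul_mx_scalar rmorphN scaleNr subrr.
have b_le0 y : '[y *m b, y] <= 0.
  rewrite mulmxDr mul_mx_scalar rmorphN scaleNr dotBl dotZl subr_le0.
  exact: b0l.
have bu : b *m u0^t* = 0.
  by rewrite -[b](herm_trmxC bh) -trmxC_mul ub trmx0 map_mx0.
have [B B0 hB] := bounded_entries_ex b.
have uB : bounded_entries 1 u0 by apply: bounded_entries_nrm; rewrite ?u1 ?expr1n.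
pose M := B * (8 * N%:R + 16 * N%:R ^+ 2).
have M0 : 0 <= M by rewrite mulr_ge0 ?addr_ge0 ?mulr_ge0 ?sqr_ge0// ltW.
pose r := e / (e + 2 * M).
have D0 : 0 < e + 2 * M by apply: ltr_pwDl => //; exact: mulr_ge0.
have r0 : 0 < r by rewrite divr_gt0.
have r1 : r <= 1 by rewrite ler_pdivrMr// mul1r lerDl mulr_ge0.
have rM : r * M <= e / 2.
  rewrite /r mulrAC ler_pdivrMr//.
  have -> : e / 2 * (e + 2 * M) = e * M + e * e / 2 by field.
  by rewrite lerDl divr_ge0// mulr_ge0// ltW.
(* As [k] exceeds [r ^- 2], the condition [nrm y * k <= 1] gives [nrm y <= r ^+ 2]. *)
exists u0, (Num.bound (r ^- 2)); split => // y yu yk.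
have uy := dot_eq0C yu.
have yr2 : nrm y <= r ^+ 2.
  have r2 : 0 < r ^- 2 by rewrite invr_gt0 exprn_gt0.
  rewrite -[r ^+ 2]mul1r -ler_pdivrMr ?exprn_gt0//; apply: le_trans yk.
  by rewrite ler_wpM2l ?nrm_ge0// ltW// archi_boundP// ltW.
have yB : bounded_entries r y by apply: bounded_entries_nrm => //; exact: ltW.
have yr : nrm y <= r by rewrite (le_trans yr2)// expr2 ler_piMr// ltW.
pose u := u0 + y.
have nu : nrm u = 1 + nrm y by rewrite nrmD// u1.
have nu0 : 0 < nrm u by rewrite nu ltr_pwDl// nrm_ge0.
(* [T] is [nrm u] times the projection orthogonal to [u], and [T0] is its analogue for the unit
   vector [u0]. As [T0] fixes [b] on both sides, [T *m b *m T - b] has only terms containing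
   [D = T - T0]. *)
pose T : 'M[C]_N := ((nrm u)%:C)%:M - u^t* *m u.
pose T0 : 'M[C]_N := 1%:M - u0^t* *m u0.
pose D : 'M[C]_N := ((nrm y)%:C)%:M - (u0^t* *m y + y^t* *m u0 + y^t* *m y).
have uu : u^t* *m u = u0^t* *m u0 + (u0^t* *m y + y^t* *m u0 + y^t* *m y).
  by rewrite /u trmxCD mulmxDl !mulmxDr !addrA.
have uM : ((nrm u)%:C)%:M = 1%:M + ((nrm y)%:C)%:M :> 'M[C]_N.
  by rewrite nu rmorphD rmorph1 -(scalemx1 _ (1 + _)) scalerDl scale1r scalemx1.
have TE : T = T0 + D by rewrite /T uu uM opprD addrACA.
have T0b : T0 *m b = b by rewrite mulmxBl mul1mx -mulmxA ub mulmx0 subr0.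
have bT0 : b *m T0 = b by rewrite mulmxBr mulmx1 mulmxA bu mul0mx subr0.
have DB : bounded_entries (4 * r) D.
  have := bounded_entriesD (bounded_entriesW yr (bounded_entries_scalar (nrm_ge0 y)))
    (bounded_entriesN (bounded_entriesD (bounded_entriesD
      (bounded_entriesM (bounded_entries_trmxC uB) yB)
      (bounded_entriesM (bounded_entries_trmxC yB) uB))
      (bounded_entriesM (bounded_entries_trmxC yB) yB))).
  apply: bounded_entriesW; have rr : r * r <= r by rewrite ler_piMr// ltW.
  rewrite !mul1r mulr1 (_ : 4 * r = r + (r + r + r)); last by ring.
  by rewrite !lerD2l.
have Th : T \is hermsymmx := hermB (herm_scalar _ _) (herm_rank1 u).
have uT : u *m T = 0 by rewrite mulmxBr mul_mx_scalar mul_rank1 nrmE subrr.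
have yT z : '[z, u] = 0 -> z *m T = (nrm u)%:C *: z.
  by move=> zu; rewrite mulmxBr mul_mx_scalar mul_rank1 zu scale0r subr0.
(* [b + c] is hermitian and close to [b], with [u] as its top eigenvector. *)
pose c := (e / 8)%:C *: (u^t* *m u) + (D *m b + b *m D + D *m b *m D).
have cE : b + c = (e / 8)%:C *: (u^t* *m u) + T *m b *m T.
  rewrite /c addrCA; congr (_ + _).
  by rewrite TE (mulmx_compress _ T0b bT0).
have uh : (e / 8)%:C *: (u^t* *m u) + T *m b *m T \is hermsymmx.
  apply: hermD; first by apply: hermZ; exact: herm_rank1.
  apply/hermP; rewrite !trmxC_mul (herm_trmxC Th) (herm_trmxC bh).
  by rewrite mulmxA.
have Ic : I (b + c).
  apply: hb.
    have -> : c = b + c - b by rewrite addrC addKr.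
    by rewrite cE; exact: hermB uh bh.
  have u2 : bounded_entries 2 u.
    by apply: bounded_entriesW (bounded_entriesD uB yB); exact: lerD (lexx 1) r1.
  have := bounded_entriesD
    (bounded_entriesZ (_ : 0 <= e / 8) (bounded_entriesM (bounded_entries_trmxC u2) u2))
    (bounded_entriesD
      (bounded_entriesD (bounded_entriesM DB hB) (bounded_entriesM hB DB))
      (bounded_entriesM (bounded_entriesM DB hB) DB)).
  have e8 : 0 <= e / 8 by rewrite divr_ge0// ltW.
  move=> /(_ e8); apply: bounded_entriesW.
  by rewrite mul1r; exact: cap_bound (ler0n R N) (ltW B0) (ltW r0) r1 rM.
apply: (@line_top _ _ _ hI (b + c) u (e / 8 * nrm u) 0) => //.
- by rewrite -nrm_gt0.
- rewrite cE mulmxDr -scalemxAr mul_rank1 nrmE scalerA -rmorphM.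
  by rewrite !mulmxA uT !mul0mx addr0.
- by rewrite mulr_gt0// divr_gt0.
(* On the complement of [u] only the compression of [b] survives, and it is nonpositive; hence the
   threshold 0. *)
move=> z zu; rewrite cE mulmxDr -scalemxAr mul_rank1 zu scale0r scaler0 add0r.
rewrite rmorph0 mul0r mulmxA (dot_herm _ _ Th) mulmxA; exact: b_le0.
Qed.

End Interior.

Theorem theorem10 (R : realType) (N : nat) (N_ge3 : (3 <= N)%N)
    (I : set 'M[R[i]]_N) (I_isocone : isocone I) :
  I = Herm R N.
Proof.
have [u [k [u1 uk]]] := isocone_cap I_isocone (leq_trans (isT : (0 < 3)%N) N_ge3).
exact: (line_herm I_isocone (cap_line I_isocone N_ge3 u1 uk)).
Qed.
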